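(* Let $K_i=[a_i,b_i,c_i,d_i]$, $i=1,2,3$, be three oriented circles (or lines) such that $U\neq 0$. Then oriented circles (or lines) $K_0=[a_0,b_0,c_0,d_0]$ tangent to all three, i.e. with $Q(K_0,K_i)=0$ for $i=1,2,3$, exist if and only if $Q_1Q_2Q_3\ge 0$, and in that case they are exactly those given by $$a_0=\frac1U\Big(\sum a_i v_j\pm\Delta_4\sqrt{Q_1Q_2Q_3}\Big),\qquad b_0=\frac1U\Big(\sum b_i v_j\pm\Delta_2\sqrt{Q_1Q_2Q_3}\Big),$$ $$c_0=\frac1U\Big(\sum c_i v_j\pm\Delta_3\sqrt{Q_1Q_2Q_3}\Big),\qquad d_0=\frac1U\Big(\sum d_i v_j\pm\Delta_1\sqrt{Q_1Q_2Q_3}\Big),$$ with the same choice of sign in all four formulas, where each sum runs over $(i,j,k)\in\{(1,2,3),(2,3,1),(3,1,2)\}$. In particular the problem has $0$, $1$ or $2$ solutions.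
   Context: An oriented circle or line is a quadruple of reals $K=[a,b,c,d]$ with $b^2+c^2-ad=1$, representing the curve $N(x,y)=a(x^2+y^2)+2bx+2cy+d=0$. Here $a$ is its signed curvature: for $a\ne0$ it is the circle of radius $1/|a|$ centred at $(-b/a,-c/a)$, for $a=0$ it is a straight line. The orientation is such that points with $N<0$ lie to the left of the curve. The reversed curve is $[-a,-b,-c,-d]$. The inversive invariant of two oriented circles or lines is defined by $4Q(K_1,K_2)=2+a_1d_2+a_2d_1-2(b_1b_2+c_1c_2)$; if the curves intersect at angle $\Psi$, then $\cos\Psi=1-2Q$. Tangency (coincidence of tangent vectors at the common point; possibly at infinity for parallel equally directed lines; an oriented circle counts as tangent to itself) means $Q=0$. Notation for a triple $K_1,K_2,K_3$: $Q_1=Q(K_1,K_2)$, $Q_2=Q(K_2,K_3)$, $Q_3=Q(K_3,K_1)$; $$U=Q_1^2+Q_2^2+Q_3^2-2(Q_1Q_2+Q_2Q_3+Q_3Q_1)+4Q_1Q_2Q_3;$$ $v_i=Q_i(Q_i-Q_j-Q_k)$ for $\{i,j,k\}=\{1,2,3\}$. Writing $\det(p_i\ q_i\ r_i)$ for the $3\times3$ determinant whose $i$-th row is $(p_i,q_i,r_i)$, $i=1,2,3$: $$\Delta_4=\det(a_i\ b_i\ c_i),\quad \Delta_1=-\det(b_i\ c_i\ d_i),\quad \Delta_2=-\tfrac12\det(a_i\ c_i\ d_i),\quad \Delta_3=\tfrac12\det(a_i\ b_i\ d_i).$$ *)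

(* Defs.v *)
From mathcomp Require Import all_boot all_order all_algebra.
From mathcomp Require Import all_classical all_reals.

Set Implicit Arguments.
Unset Strict Implicit.
Unset Printing Implicit Defensive.

Import Order.TTheory GRing.Theory Num.Theory.

Local Open Scope ring_scope.
Local Open Scope classical_set_scope.

(* The quadruple [a, b, c, d] stands for the curve
   a (x^2 + y^2) + 2 b x + 2 c y + d = 0 with the points where the left-hand
   side is negative lying to its left; [-a, -b, -c, -d] is the reversed curve. *)
Record quadruple (R : Type) := Quadruple {
  qa : R; qb : R; qc : R; qd : R }.

Definition oriented_circle (R : realType) (K : quadruple R) : Prop :=
  qb K ^+ 2 + qc K ^+ 2 - qa K * qd K = 1.

Definition inv_Q (R : realType) (K L : quadruple R) : R :=
  (2 + qa K * qd L + qa L * qd K - 2 * (qb K * qb L + qc K * qc L)) / 4.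

(* Tangent vectors coincide at the common point (cos Psi = 1 - 2 Q = 1), so
   this is sensitive to orientation, and K is tangent to itself. *)
Definition tangent (R : realType) (K L : quadruple R) : Prop := inv_Q K L = 0.

Section Triple.

(* The indices 1, 2, 3 are the elements 0, 1, 2 of 'I_3, with addition in 'I_3
   taken modulo 3, so that (i, i + 1, i + 2) runs over the cyclic
   permutations. *)
Variables (R : realType) (K : 'I_3 -> quadruple R).

Definition tQ (i : 'I_3) : R := inv_Q (K i) (K (i + 1)).

Definition tQQQ : R := \prod_(i < 3) tQ i.

Definition tU : R :=
  \sum_(i < 3) tQ i ^+ 2 - 2 * (\sum_(i < 3) tQ i * tQ (i + 1)) + 4 * tQQQ.

Definition tv (i : 'I_3) : R := tQ i * (tQ i - tQ (i + 1) - tQ (i + 2)).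

(* The determinant whose i-th row is (p (K i), q (K i), r (K i)). *)
Definition tdet (p q r : quadruple R -> R) : R :=
  \det (\matrix_(i < 3, j < 3) [:: p (K i); q (K i); r (K i)]`_j).

Definition Delta4 : R := tdet (@qa R) (@qb R) (@qc R).
Definition Delta1 : R := - tdet (@qb R) (@qc R) (@qd R).
Definition Delta2 : R := - (1 / 2) * tdet (@qa R) (@qc R) (@qd R).
Definition Delta3 : R := 1 / 2 * tdet (@qa R) (@qb R) (@qd R).

(* The quadruple [a_0, b_0, c_0, d_0] of the formulas; s = 1 or s = -1 is the
   common choice of sign. *)
Definition apollonius (s : R) : quadruple R :=
  let coord (p : quadruple R -> R) (Delta : R) : R :=
    1 / tU * (\sum_(i < 3) p (K i) * tv (i + 1) + s * Delta * Num.sqrt tQQQ) in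
  Quadruple (coord (@qa R) Delta4) (coord (@qb R) Delta2)
            (coord (@qc R) Delta3) (coord (@qd R) Delta1).

Definition tangent_circles : set (quadruple R) :=
  [set K0 | oriented_circle K0 /\ forall i, tangent K0 (K i)].

End Triple.

(* Main.v *)
Require Import Defs.
From mathcomp Require Import all_boot all_order all_algebra.
From mathcomp Require Import all_classical all_reals.
From mathcomp Require Import ring lra.

Set Implicit Arguments.
Unset Strict Implicit.
Unset Printing Implicit Defensive.

Import Order.TTheory GRing.Theory Num.Theory.

Local Open Scope ring_scope.
Local Open Scope classical_set_scope.
Local Open Scope card_scope.

(** Put on quadruples the Lorentzian form for which oriented circles are the
    vectors of square 1. Since Q = (1 - form) / 2, tangency of K0 to K i reads
    form K0 (K i) = 1, so a solution is a vector of square 1 on an affine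
    subspace cut out by three linear equations.

    The Gram determinant of the three circles is - 4 U, so U <> 0 makes that
    subspace a line: its direction is the cross product N = (Delta4, Delta2,
    Delta3, Delta1), which spans the orthogonal complement of the three
    circles (orthogonal_parallel) and has square 4 U (normal_norm), and it
    passes through P = (sum K_i v_j) / U, the common projection of all
    solutions on the span of the circles (form_foot_tangent). Hence every
    solution is P + t N (tangent_circle_on_normal). As P has square
    1 - 4 Q1 Q2 Q3 / U (foot_norm), P + t N has square 1 exactly when
    (t U)^2 = Q1 Q2 Q3 (translate_tangentE). This equation has a real root if
    and only if Q1 Q2 Q3 >= 0, and its roots t = +- sqrt (Q1 Q2 Q3) / U give
    the two announced quadruples, which coincide when Q1 Q2 Q3 = 0. *)

(** * Inversive product *)

(** The Lorentzian bilinear form polarising b^2 + c^2 - a d. *)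
Definition form (R : realType) (K L : quadruple R) : R :=
  qb K * qb L + qc K * qc L - (qa K * qd L + qa L * qd K) / 2.

Definition translate (R : realType) (P : quadruple R) (t : R)
    (N : quadruple R) : quadruple R :=
  Quadruple (qa P + t * qa N) (qb P + t * qb N)
            (qc P + t * qc N) (qd P + t * qd N).

Section Form.
Variable R : realType.
Implicit Types (K L N P W : quadruple R) (t : R).

Lemma quadruple_eq K L :
  qa K = qa L -> qb K = qb L -> qc K = qc L -> qd K = qd L -> K = L.
Proof. by case: K L => [a b c d] [a' b' c' d'] /= -> -> -> ->. Qed.

Lemma formC K L : form K L = form L K.
Proof. by rewrite /form; ring. Qed.

Lemma form_translatel P t N L :
  form (translate P t N) L = form P L + t * form N L.
Proof. by rewrite /form /=; field. Qed.

Lemma form_translater P t N L :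
  form L (translate P t N) = form L P + t * form L N.
Proof. by rewrite formC form_translatel !(formC L). Qed.

Lemma form_translate P t N : form P N = 0 ->
  form (translate P t N) (translate P t N) = form P P + t ^+ 2 * form N N.
Proof.
move=> PN; rewrite form_translatel !form_translater (formC N P) PN.
by ring.
Qed.

Lemma oriented_circleE K : oriented_circle K <-> form K K = 1.
Proof.
suff -> : form K K = qb K ^+ 2 + qc K ^+ 2 - qa K * qd K by [].
by rewrite /form; field.
Qed.

Lemma inv_QE K L : inv_Q K L = (1 - form K L) / 2.
Proof. by rewrite /inv_Q /form; field. Qed.

Lemma formE K L : form K L = 1 - 2 * inv_Q K L.
Proof. by rewrite inv_QE; field. Qed.

Lemma tangentE K L : tangent K L <-> form K L = 1.
Proof. by rewrite /tangent inv_QE; split=> h; lra. Qed.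

(** One coordinate p of the relation form N N * W = form W N * N between
    vectors N and W whose 2 x 2 minors involving p vanish. *)
Lemma form_proportional (p : quadruple R -> R) N W :
    p N * qa W = p W * qa N -> p N * qb W = p W * qb N ->
    p N * qc W = p W * qc N -> p N * qd W = p W * qd N ->
  p N * form W N = p W * form N N.
Proof.
move=> ea eb ec ed.
transitivity (p N * qb W * qb N + p N * qc W * qc N
              - (p N * qa W * qd N + p N * qd W * qa N) / 2).
  by rewrite /form; field.
by rewrite ea eb ec ed /form; field.
Qed.

End Form.

(** * Three indices, and sets of two elements *)

Lemma ord3_addE :
  (((0 + 1)%R = 1%R :> 'I_3) * ((0 + 2)%R = 2%R :> 'I_3) *
   ((1 + 1)%R = 2%R :> 'I_3) * ((1 + 2)%R = 0%R :> 'I_3) *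
   ((2 + 1)%R = 0%R :> 'I_3) * ((2 + 2)%R = 1%R :> 'I_3))%type.
Proof. by do !split; apply: val_inj. Qed.

Lemma card_pair (T : Type) (x y : T) : x <> y -> [set x; y] #= `I_2.
Proof.
move=> xy; have -> : [set x; y] = (fun n => if n is 0%N then x else y) @` `I_2.
  apply/seteqP; split=> z /=.
    by case=> ->; [exists 0%N|exists 1%N].
  by case=> [[|n]] _ <-; [left|right].
apply: inj_card_eq => m n; rewrite !inE /=.
by case: m n => [|[|m]] [|[|n]] //= _ _ // /esym.
Qed.

Lemma ord3_ind (A : 'I_3 -> Prop) : A 0 -> A 1 -> A 2 -> forall i, A i.
Proof.
move=> A0 A1 A2 [[|[|[|//]]] lti].
- by rewrite (_ : Ordinal lti = 0) //; apply: val_inj.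
- by rewrite (_ : Ordinal lti = 1) //; apply: val_inj.
- by rewrite (_ : Ordinal lti = 2) //; apply: val_inj.
Qed.

Lemma big_ord3 (T : Type) (x : T) (op : Monoid.law x) (F : 'I_3 -> T) :
  \big[op/x]_(i < 3) F i = op (F 0) (op (F 1) (F 2)).
Proof.
rewrite !big_ord_recl big_ord0 Monoid.mulm1.
by congr (op (F _) (op (F _) (F _))); apply: val_inj.
Qed.

(** * The normal and the projection of a solution *)

Section Triple.
Variables (R : realType) (K : 'I_3 -> quadruple R).

Lemma tdetE (p q r : quadruple R -> R) :
  tdet K p q r = p (K 0) * (q (K 1) * r (K 2) - r (K 1) * q (K 2))
               - q (K 0) * (p (K 1) * r (K 2) - r (K 1) * p (K 2))
               + r (K 0) * (p (K 1) * q (K 2) - q (K 1) * p (K 2)).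
Proof.
rewrite /tdet (expand_det_row _ 0) big_ord3 /cofactor.
rewrite !(expand_det_row _ (0 : 'I_2)) !big_ord_recl !big_ord0 /cofactor.
rewrite !det_mx11 !mxE /=.
have lift0 : lift 0 (0 : 'I_2) = 1 :> 'I_3 by apply: val_inj.
have lift1 : lift 0 (lift 0 (0 : 'I_1)) = 2 :> 'I_3 by apply: val_inj.
rewrite !lift0 !lift1 /bump /= !modn_small //.
by ring.
Qed.

(** The generalised cross product of the three circles for the Lorentzian
    form. *)
Definition normal : quadruple R :=
  Quadruple (Delta4 K) (Delta2 K) (Delta3 K) (Delta1 K).

(** The orthogonal projection of any solution onto the span of the three
    circles. *)
Definition foot : quadruple R :=
  let coord (p : quadruple R -> R) :=
    1 / tU K * (\sum_(i < 3) p (K i) * tv K (i + 1)) in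
  Quadruple (coord (@qa R)) (coord (@qb R)) (coord (@qc R)) (coord (@qd R)).

Lemma apolloniusE s :
  apollonius K s = translate foot (s * Num.sqrt (tQQQ K) / tU K) normal.
Proof. by apply: quadruple_eq => /=; ring. Qed.

(** For every L, form normal L is up to a constant the 4 x 4 determinant with
    rows K 0, K 1, K 2 and L; it vanishes when L repeats a row. *)
Lemma form_normal i : form normal (K i) = 0.
Proof.
rewrite /form /normal /= /Delta1 /Delta2 /Delta3 /Delta4 !tdetE.
by elim/ord3_ind: i; field.
Qed.

(** Cauchy-Binet in signature (3, 1): the square of the cross product is minus
    the Gram determinant. *)
Lemma form_normal_normal : let g i j := form (K i) (K j) in
  form normal normal =
    g 0 0 * g 1 2 ^+ 2 + g 1 1 * g 2 0 ^+ 2 + g 2 2 * g 0 1 ^+ 2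
    - g 0 0 * g 1 1 * g 2 2 - 2 * (g 0 1 * g 1 2 * g 2 0).
Proof.
rewrite /= /form /normal /= /Delta1 /Delta2 /Delta3 /Delta4 !tdetE.
by field.
Qed.
Lemma form_foot L :
  form foot L = (\sum_(i < 3) form (K i) L * tv K (i + 1)) / tU K.
Proof. by rewrite /form /foot /= !big_ord3 /=; ring. Qed.

Lemma form_foot_normal : form foot normal = 0.
Proof.
rewrite form_foot big1 ?mul0r // => i _.
by rewrite formC form_normal mul0r.
Qed.

(** The orthogonal complement of the three circles is spanned by their cross
    product. Every 2 x 2 minor of normal and W is, up to a constant, a 3 x 3
    determinant one of whose columns is form W (K i), and that column is
    zero. *)
Lemma orthogonal_parallel W : (forall i, form W (K i) = 0) ->
  let parallel p := p normal * form W normal = p W * form normal normal in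
  [/\ parallel (@qa R), parallel (@qb R), parallel (@qc R)
    & parallel (@qd R)].
Proof.
move=> hW parallel.
have det0 k p r : k * tdet K p (form W) r = 0.
  by rewrite tdetE !hW; ring.
have minor0 k p r x y : x - y = k * tdet K p (form W) r -> x = y.
  by rewrite det0 => /eqP; rewrite subr_eq0 => /eqP.
have eab : qa normal * qb W = qa W * qb normal.
  apply: (minor0 1 (@qa R) (@qc R)).
  by rewrite /normal /= /Delta2 /Delta4 !tdetE /form; field.
have eac : qa normal * qc W = qa W * qc normal.
  apply: (minor0 (-1) (@qa R) (@qb R)).
  by rewrite /normal /= /Delta3 /Delta4 !tdetE /form; field.
have ead : qa normal * qd W = qa W * qd normal.
  apply: (minor0 2 (@qb R) (@qc R)).
  by rewrite /normal /= /Delta1 /Delta4 !tdetE /form; field.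
have ebc : qb normal * qc W = qb W * qc normal.
  apply: (minor0 (- (1 / 2)) (@qa R) (@qd R)).
  by rewrite /normal /= /Delta2 /Delta3 !tdetE /form; field.
have ebd : qb normal * qd W = qb W * qd normal.
  apply: (minor0 (-1) (@qc R) (@qd R)).
  by rewrite /normal /= /Delta2 /Delta1 !tdetE /form; field.
have ecd : qc normal * qd W = qc W * qd normal.
  apply: (minor0 1 (@qb R) (@qd R)).
  by rewrite /normal /= /Delta3 /Delta1 !tdetE /form; field.
by split; apply: form_proportional; lra.
Qed.

(** * Solutions on the normal line *)

Section Unit.
Hypothesis hK : forall i, oriented_circle (K i).

Let form_self i : form (K i) (K i) = 1.
Proof. exact/oriented_circleE. Qed.

Lemma tU_expand : tU K = tQ K 0 ^+ 2 + tQ K 1 ^+ 2 + tQ K 2 ^+ 2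
  - 2 * (tQ K 0 * tQ K 1 + tQ K 1 * tQ K 2 + tQ K 2 * tQ K 0)
  + 4 * tQ K 0 * tQ K 1 * tQ K 2.
Proof. by rewrite /tU /tQQQ !big_ord3 /= !ord3_addE; ring. Qed.

(** In terms of Q = (1 - form) / 2, the Gram determinant of three unit vectors
    is - 4 U. *)
Lemma normal_norm : form normal normal = 4 * tU K.
Proof.
rewrite form_normal_normal /= !form_self tU_expand /tQ !ord3_addE !formE.
by ring.
Qed.

Hypothesis hU : tU K <> 0.
Let U_neq0 : tU K != 0. Proof. exact/eqP. Qed.

(** The weights v_j / U solve the Gram system with right-hand side
    (1, 1, 1). *)
Lemma form_foot_tangent i : form foot (K i) = 1.
Proof.
apply: (mulIf U_neq0); rewrite form_foot divfK // mul1r tU_expand.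
rewrite big_ord3 /tv !ord3_addE.
elim/ord3_ind: i; rewrite /= form_self.
- rewrite (formC (K 1) (K 0)) !formE /tQ !ord3_addE; ring.
- rewrite (formC (K 2) (K 1)) !formE /tQ !ord3_addE; ring.
- rewrite (formC (K 0) (K 2)) !formE /tQ !ord3_addE; ring.
Qed.

(** Since foot is a combination of the K i, each having product 1 with foot,
    its square is the sum of the weights v_j / U. *)
Lemma foot_norm : form foot foot = 1 - 4 * tQQQ K / tU K.
Proof.
apply: (mulIf U_neq0); rewrite form_foot mulrBl !divfK // mul1r.
under eq_bigr => i _ do rewrite formC form_foot_tangent mul1r.
by rewrite tU_expand /tQQQ !big_ord3 /= /tv !ord3_addE; ring.
Qed.

(** All points of the line through foot along normal satisfy the three tangency
    equations, so only the normalisation remains; by Pythagoras it is a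
    quadratic equation in t, with constant term given by foot_norm. *)
Lemma translate_tangentE t :
  tangent_circles K (translate foot t normal) <-> (t * tU K) ^+ 2 = tQQQ K.
Proof.
have tanP i : tangent (translate foot t normal) (K i).
  apply/tangentE; rewrite form_translatel form_foot_tangent form_normal.
  by rewrite mulr0 addr0.
have normE : form (translate foot t normal) (translate foot t normal) - 1
    = 4 / tU K * ((t * tU K) ^+ 2 - tQQQ K).
  rewrite (form_translate _ form_foot_normal) foot_norm normal_norm.
  by field.
have c_neq0 : 4 / tU K != 0 by rewrite mulf_neq0 ?invr_eq0 ?pnatr_eq0.
split=> [[/oriented_circleE h _]|h].
  move/eqP: normE; rewrite h subrr eq_sym mulf_eq0 (negbTE c_neq0) subr_eq0.
  by move/eqP.
split=> //; apply/oriented_circleE.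
by apply/eqP; rewrite -subr_eq0 normE h subrr mulr0.
Qed.

(** A solution and foot have the same product 1 with each K i, so their
    difference is orthogonal to the three circles; normal is not isotropic
    because U is nonzero. *)
Lemma tangent_circle_on_normal K0 : tangent_circles K K0 ->
  exists t, K0 = translate foot t normal.
Proof.
move=> [_ /(_ _)/tangentE tanK0].
pose W := translate K0 (- 1) foot.
have /orthogonal_parallel[ea eb ec ed] : forall i, form W (K i) = 0.
  by move=> i; rewrite form_translatel tanK0 form_foot_tangent mulr1 subrr.
have NN_neq0 : form normal normal != 0.
  by rewrite normal_norm mulf_neq0 ?pnatr_eq0.
have solve x y z : y * form W normal = (x + -1 * z) * form normal normal ->
    x = z + form W normal / form normal normal * y.
  by move=> e; apply: (mulIf NN_neq0); rewrite mulrDl mulrAC divfK //; lra.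
by exists (form W normal / form normal normal); apply: quadruple_eq;
  apply: solve.
Qed.

End Unit.
End Triple.

(** * The Apollonius problem *)

Theorem mainTheorem1 (R : realType) (K : 'I_3 -> quadruple R)
    (hK : forall i, oriented_circle (K i)) (hU : tU K <> 0) :
  [/\ tangent_circles K !=set0 <-> 0 <= tQQQ K,
      0 <= tQQQ K ->
        tangent_circles K = [set apollonius K 1; apollonius K (- 1)]
    & [\/ tangent_circles K #= `I_0, tangent_circles K #= `I_1
        | tangent_circles K #= `I_2] ].
Proof.
have Q_ge0 K0 : tangent_circles K K0 -> 0 <= tQQQ K.
  move=> h; have [t e] := tangent_circle_on_normal hK hU h.
  move: h; rewrite e => /(translate_tangentE hK hU) <-.
  exact: sqr_ge0.
have U_neq0 : tU K != 0 by exact/eqP.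
have solutions : 0 <= tQQQ K ->
    tangent_circles K = [set apollonius K 1; apollonius K (- 1)].
  move=> Q0; rewrite !apolloniusE; apply/seteqP; split=> [K0 h|K0].
    have [t e] := tangent_circle_on_normal hK hU h.
    move: h; rewrite e => /(translate_tangentE hK hU).
    rewrite -{1}(sqr_sqrtr Q0) => /eqP; rewrite eqf_sqr => /orP[] /eqP tU_sqrt.
      by left; rewrite mul1r -tU_sqrt mulfK.
    by right; rewrite /= mulN1r -tU_sqrt mulfK.
  by case=> ->; apply/(translate_tangentE hK hU);
    rewrite divfK // exprMn sqr_sqrtr // ?sqrrN expr1n mul1r.
split=> //.
- split=> [[K0 /Q_ge0]//|Q0].
  by exists (apollonius K 1); rewrite solutions //; left.
- have [Q0|Q0] := leP 0 (tQQQ K); last first.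
    apply: Or31; rewrite II0 card_eq0; apply/eqP/seteqP; split=> // K0 /Q_ge0.
    by rewrite leNgt Q0.
  rewrite solutions //.
  have [->|neq] := pselect (apollonius K 1 = apollonius K (- 1)).
    by apply: Or32; rewrite setUid; exact: card_set1.
  by apply: Or33; exact: card_pair.
Qed.
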